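(* Let $\alpha_\delta=(1+\delta)M\nu^{-2}\|f\|_{-1}$ and $C_\delta=2\sqrt{1+(1+\delta)^2}$, and suppose $\alpha_\delta<\frac13$. Let $u\in V$ be a steady Navier-Stokes solution, $\epsilon\in V$ the noise function with $\|\nabla(u+\epsilon)\|\le(1+\delta)\|\nabla u\|$, $u_0\in V$, and let $(u_k)_{k\ge0}\subset V$ be the CDA-Picard iterates with noisy data, defined by $$\nu(\nabla u_{k+1},\nabla v)+b(u_k,u_{k+1},v)+\mu\big(I_Hu_{k+1}-I_H(u+\epsilon),\,I_Hv\big)=(f,v)\qquad\forall v\in V .$$ Then for $k$ sufficiently large, $$\|\nabla u_{k+1}\|\le 2\nu^{-1}\|f\|_{-1}\sqrt{1+(1+\delta)^2}=C_\delta\nu^{-1}\|f\|_{-1}.$$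
   Context: $\Omega\subset\mathbb{R}^d$, $d\in\{2,3\}$, is an open connected set that is a convex polygon or has smooth boundary. $(\cdot,\cdot)$ and $\|\cdot\|$ denote the $L^2(\Omega)$ inner product and norm. $X=\{v\in H^1(\Omega)^d: v=0\text{ on }\partial\Omega\}$, $Q=\{q\in L^2(\Omega):\int_\Omega q\,dx=0\}$, $V=\{v\in X:(\nabla\cdot v,q)=0\ \forall q\in Q\}$ (the divergence-free subspace). $\nu>0$ is the viscosity, $f\in H^{-1}(\Omega)^d$ is the forcing, $(f,v)=\langle f,v\rangle$ is the duality pairing, and $\|\cdot\|_{-1}$ is the $H^{-1}$ norm (dual to $\|\nabla\cdot\|$). $b(u,w,v)=((u\cdot\nabla)w,v)$. $M$ is a constant depending only on $\Omega$ such that $b(u,w,v)\le M\|u\|^{1/2}\|\nabla u\|^{1/2}\|\nabla w\|\|\nabla v\|$ and $b(u,w,v)\le M\|\nabla u\|\|\nabla w\|\|\nabla v\|$ for $u,w,v\in X$. A steady Navier-Stokes solution is a $u\in V$ with $\nu(\nabla u,\nabla v)+b(u,u,v)=\langle f,v\rangle$ for all $v\in V$; the paper assumes throughout that $\|\nabla u\|_{L^\infty}<\infty$. Data assimilation: $H>0$ is the width of a coarse mesh of $\Omega$, and $I_H$ is a (linear) coarse mesh interpolation operator for which there is a constant $C_I>0$ independent of $H$ with $\|I_Hv-v\|\le C_IH\|\nabla v\|$ and $\|I_Hv\|\le C_I\|v\|$ for all $v\in X$. $\mu>0$ is the nudging parameter. The known data are $u(x_i)+\epsilon_i$ at measurement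 points $x_i$; $\epsilon\in V$ is any divergence-free function with $I_H\epsilon(x_i)=\epsilon_i$, and $\delta\ge0$ is the relative noise size constant in $\|\nabla(u+\epsilon)\|\le(1+\delta)\|\nabla u\|$. *)

(* Defs.v *)
From HB Require Import structures.
From mathcomp Require Import all_boot all_order all_algebra.
From mathcomp Require Import all_classical all_reals all_analysis.
From mathcomp Require Import ess_sup_inf.

Set Implicit Arguments.
Unset Strict Implicit.
Unset Printing Implicit Defensive.

Import Order.TTheory GRing.Theory Num.Theory.
Import numFieldNormedType.Exports.

Local Open Scope classical_set_scope.
Local Open Scope ring_scope.

(* The sigma-algebra on R^n = 'rV[R]_n is generated by the coordinates, i.e.  *)
(* it is the Borel sigma-algebra.                                             *)
Definition rV_display : measure_display.
Proof. exact. Qed.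

Section rV_measurable.
Context (R : realType) (n : nat).

Definition rV_coord (i : 'I_n) (x : 'rV[R]_n) : measurableTypeR R := x 0 i.

Let rV_set0 : g_sigma_preimage rV_coord set0.
Proof. exact: sigma_algebra0. Qed.

Let rV_setC A : g_sigma_preimage rV_coord A -> g_sigma_preimage rV_coord (~` A).
Proof. exact: sigma_algebraC. Qed.

Let rV_bigcup (F : _^nat) : (forall i, g_sigma_preimage rV_coord (F i)) ->
  g_sigma_preimage rV_coord (\bigcup_i (F i)).
Proof. exact: sigma_algebra_bigcup. Qed.

HB.instance Definition _ := @isMeasurable.Build rV_display
  'rV[R]_n (g_sigma_preimage rV_coord) rV_set0 rV_setC rV_bigcup.

End rV_measurable.

Lemma measurable_rV_coord (R : realType) n (i : 'I_n) :
  measurable_fun [set: 'rV[R]_n] (@rV_coord R n i).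
Proof.
move=> _ Y mY; rewrite setTI; apply: sub_sigma_algebra => /=.
rewrite -bigcup_seq/=; exists i => /=; first by rewrite mem_index_enum.
by exists Y => //; rewrite setTI.
Qed.

Lemma measurable_fun_rV (R : realType) n d (T : measurableType d)
    (f : T -> 'rV[R]_n) :
  (forall i, measurable_fun [set: T] (@rV_coord R n i \o f)) ->
  measurable_fun [set: T] f.
Proof.
move=> mf.
suff prefS : g_sigma_preimage (fun i => @rV_coord R n i \o f) `<=` measurable.
  move=> _ A mA; rewrite setTI; apply: prefS.
  by rewrite g_sigma_preimage_comp; exists A => //; rewrite setTI.
apply: smallest_sub; first exact: sigma_algebra_measurable.
rewrite -bigcup_seq => A [i _ [B mB <-]].
exact: mf.
Qed.

Section rV_cons.
Context (R : realType) (n : nat).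

Definition rV_cons (p : measurableTypeR R * 'rV[R]_n) : 'rV[R]_n.+1 :=
  row_mx ((p.1 : R)%:M : 'M[R]_1) p.2.

Definition rV_uncons (x : 'rV[R]_n.+1) : measurableTypeR R * 'rV[R]_n :=
  (rV_coord ord0 x, \row_j x 0 (lift ord0 j)).

Lemma rV_consK : cancel rV_cons rV_uncons.
Proof.
move=> [a x]; congr (_, _); rewrite /rV_coord /rV_cons /=.
  have -> : ord0 = lshift n (0 : 'I_1) :> 'I_n.+1 by apply/val_inj.
  by rewrite (@row_mxEl _ 1 1 n) mxE eqxx mulr1n.
apply/rowP => j; rewrite mxE.
have -> : lift ord0 j = rshift 1 j :> 'I_n.+1 by apply/val_inj.
by rewrite (@row_mxEr _ 1 1 n).
Qed.

Lemma measurable_rV_cons : measurable_fun setT rV_cons.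
Proof.
apply: measurable_fun_rV => i.
have [->|i0] := eqVneq i ord0.
  rewrite (_ : _ \o _ = fst); first exact: measurable_fst.
  by apply/funext => p; have := rV_consK p; move=> /(congr1 fst).
have [j ->] : exists j, i = lift ord0 j.
  by move: i0; case: (unliftP ord0 i) => [j ->|->]; [exists j|rewrite eqxx].
rewrite (_ : _ \o _ = @rV_coord R n j \o snd).
  apply: measurableT_comp; [exact: measurable_rV_coord|exact: measurable_snd].
apply/funext => p; have := rV_consK p.
by move=> /(congr1 snd) /= <-; rewrite /rV_coord !mxE.
Qed.

HB.instance Definition _ :=
  isMeasurableFun.Build _ _ _ _ rV_cons measurable_rV_cons.

Lemma measurable_rV_uncons : measurable_fun setT rV_uncons.
Proof.
apply: measurable_fun_pair; first exact: measurable_rV_coord.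
apply: measurable_fun_rV => i.
rewrite (_ : _ \o _ = @rV_coord R n.+1 (lift ord0 i)).
  exact: measurable_rV_coord.
by apply/funext => x /=; rewrite /rV_coord mxE.
Qed.

End rV_cons.

Section lebesgue_step.
Context (R : realType) (n : nat).
Variable mu : {sigma_finite_measure set 'rV[R]_n -> \bar R}.
Local Open Scope ereal_scope.

Definition lebesgue_step : set 'rV[R]_n.+1 -> \bar R :=
  pushforward (@lebesgue_measure R \x mu) (@rV_cons R n).

Let step0 : lebesgue_step set0 = 0.
Proof. by rewrite /lebesgue_step /pushforward preimage_set0 measure0. Qed.

Let step_ge0 A : 0 <= lebesgue_step A.
Proof. exact: measure_ge0. Qed.

Let step_sigma_additive : semi_sigma_additive lebesgue_step.
Proof.
move=> F mF tF mUF; rewrite /lebesgue_step /pushforward preimage_bigcup.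
apply: measure_semi_sigma_additive.
- by move=> i; rewrite -[X in measurable X]setTI; exact: measurable_rV_cons.
- apply/trivIsetP => /= i j _ _ ij; rewrite -preimage_setI.
  by move/trivIsetP : tF => /(_ _ _ _ _ ij) ->//; rewrite preimage_set0.
- rewrite -preimage_bigcup -[X in measurable X]setTI.
  exact: measurable_rV_cons.
Qed.

HB.instance Definition _ := isMeasure.Build _ _ _
  lebesgue_step step0 step_ge0 step_sigma_additive.

Let step_sigma_finite : sigma_finite setT lebesgue_step.
Proof.
have /sigma_finiteP[F [TF ndF mF]] :
  sigma_finite setT (@lebesgue_measure R) by exact: sigma_finiteT.
have /sigma_finiteP[G [TG ndG mG]] : sigma_finite setT mu.
  exact: sigma_finiteT.
exists (fun i => @rV_uncons R n @^-1` (F i `*` G i)).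
  apply/esym/seteqP; split => // x _.
  have [i _ Fi] : (\bigcup_i F i) (rV_uncons x).1 by rewrite -TF.
  have [j _ Gj] : (\bigcup_i G i) (rV_uncons x).2 by rewrite -TG.
  exists (maxn i j) => //; split.
    by move: Fi; apply: subsetPset; apply: ndF; exact: leq_maxl.
  by move: Gj; apply: subsetPset; apply: ndG; exact: leq_maxr.
move=> i; split.
  rewrite -[X in measurable X]setTI; apply: measurable_rV_uncons => //.
  by apply: measurableX; [exact: (mF i).1|exact: (mG i).1].
rewrite /lebesgue_step /pushforward -comp_preimage.
rewrite (_ : _ \o _ = id) ?preimage_id; last first.
  by apply/funext => p; exact: rV_consK.
rewrite product_measure1E; [|exact: (mF i).1|exact: (mG i).1].
by apply: lte_mul_pinfty => //; [rewrite ge0_fin_numE//; exact: (mF i).2|exact: (mG i).2].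
Qed.

HB.instance Definition _ := Measure_isSigmaFinite.Build _ _ _
  lebesgue_step step_sigma_finite.

End lebesgue_step.

Fixpoint lebesgue_rV (R : realType) (n : nat) :
    {sigma_finite_measure set 'rV[R]_n -> \bar R} :=
  match n with
  | 0 => \d_(0 : 'rV[R]_0)
  | m.+1 => lebesgue_step (lebesgue_rV R m)
  end.

Section domains.
Context (R : realType) (d : nat).
Local Notation E := 'rV[R]_d.
Implicit Types (Omega : set E) (rho phi : E -> R).

Definition partial (i : 'I_d) rho : E -> R := 'D_(delta_mx 0 i : E) rho.

Fixpoint class_C (k : nat) rho : Prop :=
  match k with
  | 0 => continuous rho
  | m.+1 => [/\ continuous rho,
                forall i x, derivable rho x (delta_mx 0 i : E) &
                forall i, class_C m (partial i rho)]
  end.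

Definition smooth rho : Prop := forall k, class_C k rho.

(* A bounded finite intersection of open half-spaces (a convex polygon for    *)
(* d = 2, a convex polyhedron for d = 3).                                     *)
Definition convex_polytope Omega : Prop :=
  bounded_set Omega /\
  exists (N : nat) (a : 'I_N -> E) (c : 'I_N -> R),
    (forall i, a i != 0) /\
    Omega = [set x | forall i, \sum_j a i 0 j * x 0 j < c i].

(* Omega lies locally on one side of a smooth hypersurface: near each boundary *)
(* point it is the negativity set of a smooth function with nonzero gradient. *)
Definition smooth_boundary Omega : Prop :=
  forall x, (closure Omega `\` interior Omega) x ->
    exists (U : set E) rho,
      [/\ nbhs x U, smooth rho, exists i, partial i rho x != 0 &
          Omega `&` U = [set y | rho y < 0] `&` U].

Definition flow_domain Omega : Prop :=
  [/\ open Omega, connected Omega &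
      convex_polytope Omega \/ smooth_boundary Omega].

Definition test_function Omega phi : Prop :=
  [/\ smooth phi, compact (closure [set x | phi x != 0]) &
      closure [set x | phi x != 0] `<=` Omega].

End domains.

Section spaces.
Context (R : realType) (d : nat).
Local Notation E := 'rV[R]_d.
Local Notation leb := (lebesgue_rV R d).
Variable Omega : set E.

Definition L2 (q : E -> R) : Prop :=
  measurable_fun Omega q /\ leb.-integrable Omega (fun x => (q x ^+ 2)%:E).

Definition L2mx m n (F : E -> 'M[R]_(m, n)) : Prop :=
  forall i j, L2 (fun x => F x i j).

Definition frob m n (A B : 'M[R]_(m, n)) : R := \sum_i \sum_j A i j * B i j.

Definition dotL2 m n (F G : E -> 'M[R]_(m, n)) : R :=
  \int[leb]_(x in Omega) frob (F x) (G x).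

Definition normL2 m n (F : E -> 'M[R]_(m, n)) : R := Num.sqrt (dotL2 F F).

(* A weakly differentiable vector field is given together with its weak       *)
(* gradient (which it determines up to a null set): v = (v.1, v.2), where     *)
(* v.2 x i j stands for the i-th partial derivative of the j-th component.    *)
(* Sums and multiples are those of the product of function spaces.            *)
Definition vfield : lmodType R := ((E -> E) * (E -> 'M[R]_d))%type.

Definition weak_gradient (u : E -> E) (G : E -> 'M[R]_d) : Prop :=
  forall (i j : 'I_d) (phi : E -> R), test_function Omega phi ->
    \int[leb]_(x in Omega) (u x 0 j * partial i phi x) =
    - \int[leb]_(x in Omega) (G x i j * phi x).

Definition grad (phi : E -> E) (x : E) : 'M[R]_d :=
  \matrix_(i, j) partial i (fun y => phi y 0 j) x.

Definition inH1 (v : vfield) : Prop :=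
  [/\ L2mx v.1, L2mx v.2 & weak_gradient v.1 v.2].

(* v = 0 on the boundary, in the sense of H^1: v is an H^1-limit of smooth    *)
(* fields with compact support in Omega.                                      *)
Definition zero_on_boundary (v : vfield) : Prop :=
  exists phi : nat -> E -> E,
    [/\ forall n j, test_function Omega (fun x => phi n x 0 j),
        (fun n => normL2 (fun x => phi n x - v.1 x)) @ \oo --> (0 : R) &
        (fun n => normL2 (fun x => grad (phi n) x - v.2 x)) @ \oo --> (0 : R)].

Definition inX (v : vfield) : Prop := inH1 v /\ zero_on_boundary v.

(* On a domain of infinite measure, the condition below requires the extended *)
(* integral to exist and vanish; [Rintegral] would also accept infinity.      *)
Definition inQ (q : E -> R) : Prop :=
  L2 q /\ (\int[leb]_(x in Omega) (q x)%:E = 0)%E.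

Definition inV (v : vfield) : Prop :=
  inX v /\
  forall q, inQ q -> \int[leb]_(x in Omega) (\tr (v.2 x) * q x) = 0.

(* (u . nabla) w : component j is \sum_i u_i * (d_i w_j). *)
Definition convection (u w : vfield) (x : E) : E := u.1 x *m w.2 x.

Definition trilin (u w v : vfield) : R := dotL2 (convection u w) v.1.

(* The first clause says that the integral defining trilin u w v converges;   *)
(* without it the bounds would be about the default value of [Rintegral].     *)
Definition trilinear_bounds (M : R) : Prop :=
  forall u w v : vfield, inX u -> inX w -> inX v ->
    [/\ leb.-integrable Omega (fun x => (frob (convection u w x) (v.1 x))%:E),
        trilin u w v <= M * Num.sqrt (normL2 u.1) * Num.sqrt (normL2 u.2)
                     * normL2 w.2 * normL2 v.2 &
        trilin u w v <= M * normL2 u.2 * normL2 w.2 * normL2 v.2].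

(* A functional f on X belongs to H^{-1}(Omega)^d; f v is <f, v>. *)
Definition inHm1 (f : vfield -> R) : Prop :=
  (forall (a : R) (v w : vfield), inX v -> inX w ->
    f (a *: v + w) = a * f v + f w) /\
  exists C : R, forall v, inX v -> `|f v| <= C * normL2 v.2.

Definition normHm1 (f : vfield -> R) : R :=
  sup [set `|f v| / normL2 v.2 | v in [set v | inX v /\ normL2 v.2 != 0]].

Definition Linfty_gradient (v : vfield) : Prop :=
  (ess_sup leb ((fun x => `|v.2 x|%:E) \_ Omega) < +oo)%E.

Definition steady_NS (nu : R) (f : vfield -> R) (u : vfield) : Prop :=
  inV u /\ forall v, inV v -> nu * dotL2 u.2 v.2 + trilin u u v = f v.

(* A coarse mesh interpolation operator is only required to be linear up to   *)
(* null sets.                                                                 *)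
Definition coarse_interpolation (H C_I : R) (I_H : (E -> E) -> E -> E) : Prop :=
  [/\ forall (a : R) (v w : vfield), inX v -> inX w ->
        {ae leb, forall x, Omega x ->
           I_H (a *: v.1 + w.1) x = a *: I_H v.1 x + I_H w.1 x},
      forall v, inX v -> L2mx (I_H v.1),
      forall v, inX v ->
        normL2 (fun x => I_H v.1 x - v.1 x) <= C_I * H * normL2 v.2 &
      forall v, inX v -> normL2 (I_H v.1) <= C_I * normL2 v.1].

(* One step of the nudged Picard iteration, from uk to uk1, with data w. *)
Definition CDA_Picard_step (nu mu : R) (f : vfield -> R)
    (I_H : (E -> E) -> E -> E) (w uk uk1 : vfield) : Prop :=
  forall v, inV v ->
    nu * dotL2 uk1.2 v.2 + trilin uk uk1 v
      + mu * dotL2 (fun x => I_H uk1.1 x - I_H w.1 x) (I_H v.1) = f v.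

End spaces.

Definition alpha_delta (R : realType) (delta M nu F : R) : R :=
  (1 + delta) * M * nu ^- 2 * F.

Definition C_delta (R : realType) (delta : R) : R :=
  2 * Num.sqrt (1 + (1 + delta) ^+ 2).

(* Main.v *)
Require Import Defs.
From HB Require Import structures.
From mathcomp Require Import all_boot all_order all_algebra.
From mathcomp Require Import all_classical all_reals all_analysis.
From mathcomp Require Import measurable_realfun ring lra.

Set Implicit Arguments.
Unset Strict Implicit.
Unset Printing Implicit Defensive.

Import Order.TTheory GRing.Theory Num.Theory.
Import numFieldNormedType.Exports.

Local Open Scope classical_set_scope.
Local Open Scope ring_scope.

(** Write F for the dual norm of f, w = u + eps, and A_k = |grad u_k|.

    The data enter the iteration only through w, so its k-th step is tested
    with v = u_{k+1} - w: the nudging term becomes mu |I_H (u_{k+1} - w)|^2 and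
    can be dropped, which is why the bound does not depend on mu. The form b is
    skew-symmetric, so that b(u_k, u_{k+1}, v) = - b(u_k, u_{k+1}, w), and
    polarization and Young's inequality give ([nudged_Picard_energy])

      A_{k+1}^2 <= |grad w|^2 + (F / nu)^2
                     + 2 (M / nu) |grad w| A_k A_{k+1}.

    From |grad u| <= F / nu ([steady_NS_bound]) and the noise bound,
    |grad w| <= (1 + delta) F / nu. Hence the first two terms are at most
    S = (1 + (1 + delta)^2) (F / nu)^2, and (M / nu) |grad w| is at most
    alpha_delta < 1/3 when M >= 0. Splitting A_k A_{k+1} leaves
    A_{k+1}^2 <= (3/2) S + A_k^2 / 2, a contraction with fixed point 3 S. So
    eventually A_{k+1}^2 <= 4 S, and 4 S is the square of the claimed bound
    ([eventually_le_of_contraction]).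

    The analytic content is the identity b(u, v, v) = 0 for u in V and v in X
    ([trilin_skew]). For a test field phi, integration by parts shows that
    b(u, phi, phi) is - 1/2 times the integral of div u |phi|^2, and the bound
    M |grad u| |grad w| |grad v| on b extends the conclusion to X by density.
    That div u vanishes ([inV_divergence_free]) is not immediate, since V is
    defined by testing against functions of mean zero only: one tests with the
    divergences of test fields converging to u, which do have mean zero. All
    of this rests on one property of Lebesgue measure on R^n, that a partial
    derivative of a compactly supported smooth function integrates to zero
    ([integral_partial0]). *)

(** * Borel sets and continuous functions on R^n *)

Lemma ball_rV_measurable (R : realType) n (x : 'rV[R]_n) (e : R) :
  measurable (ball x e).
Proof.
have -> : ball x e = if 0 < e then
    \bigcap_(i in [set: 'I_n]) (@rV_coord R n i @^-1` (ball (x 0 i) e))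
  else set0.
  case: ifPn => e0; apply/seteqP; split => y.
  - by move=> [_ h] i _; exact: h.
  - by move=> h; split => // i j; rewrite (ord1 i); exact: h.
  - by move=> [e0']; move: e0; rewrite e0'.
  - by [].
case: ifPn => // _; apply: fin_bigcap_measurable => // i _.
rewrite -[X in measurable X]setTI; apply: measurable_rV_coord => //.
by apply: open_measurable; exact: ball_open.
Qed.

(** The sigma-algebra on R^n is generated by the coordinates, so an open set
    has to be exhibited as a countable union of boxes: the sup-norm balls with
    rational centre and radius 1/(k+1) that it contains. *)
Lemma open_rV_measurable (R : realType) n (U : set 'rV[R]_n) :
  open U -> measurable U.
Proof.
move=> oU.
pose q (p : 'rV[rat]_n * nat) : 'rV[R]_n := map_mx ratr p.1.
pose r (p : 'rV[rat]_n * nat) : R := p.2.+1%:R^-1.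
pose B p := if `[< ball (q p) (r p) `<=` U >] then ball (q p) (r p) else set0.
have -> : U = \bigcup_p B p; last first.
  apply: countable_bigcupT_measurable => [|p]; first exact: countableP.
  rewrite /B; case: ifPn => // _; exact: ball_rV_measurable.
apply/seteqP; split => [x Ux|x [p _]]; last first.
  by rewrite /B; case: ifPn => // /asboolP; apply.
have /nbhs_ballP[e /= e0 eU] : nbhs x U by exact: open_nbhs_nbhs.
have [k _ /(_ k (leqnn k)) ke] : \forall k \near \oo, k.+1%:R^-1 < e / 2.
  apply: near_infty_natSinv_lt (PosNum (divr_gt0 e0 (ltr0n R 2))).
have k0 : 0 < k.+1%:R^-1 :> R by rewrite invr_gt0 ltr0n.
have /choice[s hs] : forall i : 'I_n,
    exists s : rat, `|x 0 i - ratr s| < k.+1%:R^-1.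
  move=> i; have [|s] := @rat_in_itvoo R (x 0 i - k.+1%:R^-1)
    (x 0 i + k.+1%:R^-1).
    by rewrite ltrD2l gtrN.
  rewrite in_itv /= => /andP[h1 h2]; exists s.
  by rewrite ltr_distlC h1 h2.
exists (\row_i s i, k) => //; rewrite /B ifT.
  split => // i j; rewrite (ord1 i) !mxE; rewrite /ball /= distrC; exact: hs.
apply/asboolP => y [_ hy]; apply: eU; split => // i j; rewrite (ord1 i).
have := hy 0 j; have := hs j; rewrite !mxE /ball /= => h1 h2.
rewrite -(subrKA (ratr (s j) : R)).
apply: (le_lt_trans (ler_normD _ _)); apply: (lt_le_trans (ltrD h1 h2)).
have ke' : k.+1%:R^-1 < e / 2 := ke.
by rewrite /r /= (splitr e) ltW// ltrD.
Qed.

Lemma continuous_rV_measurable (R : realType) n (D : set 'rV[R]_n)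
  (h : 'rV[R]_n -> R) :
  measurable D -> continuous h -> measurable_fun D h.
Proof.
move=> mD ch; apply: (@measurable_funS _ _ _ _ setT) => //.
apply: (measurability _ (RGenOpens.measurableE R)).
move=> _ [_ [a [b ->] <-]]; rewrite setTI; apply: open_rV_measurable.
by apply: open_comp => [x _|]; [exact: ch|exact: interval_open].
Qed.

(** * Coordinates, norm and volume of balls in R^n *)

Lemma le_coord_norm (R : realType) n (x : 'rV[R]_n) j : `|x 0 j| <= `|x|.
Proof.
rewrite [leRHS]/Num.Def.normr /= mx_normrE; apply/bigmax_geP; right => /=.
by exists (0, j).
Qed.

Lemma norm_rV_le (R : realType) n (x : 'rV[R]_n) (L : R) : 0 <= L ->
  (forall j, `|x 0 j| <= L) -> `|x| <= L.
Proof.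
move=> L0 h; rewrite [leLHS]/Num.Def.normr /= mx_normrE; apply/bigmax_leP;
  split => //.
by move=> [i j] _ /=; rewrite (ord1 i).
Qed.

Lemma rV_cons0 (R : realType) n (a : R) (x : 'rV[R]_n) :
  rV_cons (a, x) 0 ord0 = a.
Proof. by have /(congr1 fst) := rV_consK (a, x). Qed.

Lemma rV_consS (R : realType) n (a : R) (x : 'rV[R]_n) j :
  rV_cons (a, x) 0 (lift ord0 j) = x 0 j.
Proof.
by have /(congr1 snd) /= /rowP/(_ j) := rV_consK (a, x); rewrite mxE.
Qed.

(** This identity and the next turn a difference quotient of phi along a
    coordinate axis of R^(n+1) into one of a partial application of phi,
    either in the new coordinate or in the old ones. *)
Lemma rV_cons_addl (R : realType) n (h a : R) (x : 'rV[R]_n) :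
  rV_cons (h + a, x) = h *: delta_mx 0 ord0 + rV_cons (a, x).
Proof.
apply/rowP => i; rewrite [RHS]mxE [X in _ = X + _]mxE [X in _ = _ * X + _]mxE.
case: (unliftP ord0 i) => [j ->|->].
  by rewrite !rV_consS eq_sym (negbTE (neq_lift _ _)) mulr0 add0r.
by rewrite !rV_cons0 !eqxx mulr1.
Qed.

Lemma rV_cons_addr (R : realType) n (h a : R) (x : 'rV[R]_n) j :
  rV_cons (a, h *: delta_mx 0 j + x) = h *: delta_mx 0 (lift ord0 j) + rV_cons
    (a, x).
Proof.
apply/rowP => i; rewrite [RHS]mxE [X in _ = X + _]mxE [X in _ = _ * X + _]mxE.
case: (unliftP ord0 i) => [k ->|->].
  by rewrite !rV_consS !mxE (inj_eq (@lift_inj _ ord0)).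
by rewrite !rV_cons0 (negbTE (neq_lift _ _)) andbF mulr0 add0r.
Qed.

(** Balls are boxes for the sup norm, so the ball of R^(n+1) is the product of
    an interval and a ball of R^n; its measure is then computed by recursion.
    *)
Lemma norm_rV_cons (R : realType) n (a : R) (x : 'rV[R]_n) :
  `|rV_cons (a, x)| = Num.max `|a| `|x|.
Proof.
apply/eqP; rewrite eq_le ge_max; apply/and3P; split.
- apply: norm_rV_le => [|i]; first by rewrite le_max normr_ge0.
  rewrite le_max; case: (unliftP ord0 i) => [k ->|->].
    by rewrite rV_consS le_coord_norm orbT.
  by rewrite rV_cons0 lexx.
- by have := le_coord_norm (rV_cons (a, x)) ord0; rewrite rV_cons0.
- apply: norm_rV_le => // j.
  by have := le_coord_norm (rV_cons (a, x)) (lift ord0 j); rewrite rV_consS.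
Qed.

Lemma continuous_rV_consr (R : realType) n (a : R) :
  continuous (fun x : 'rV[R]_n => rV_cons (a, x)).
Proof.
move=> x A /nbhs_ballP[e /= e0 eA]; apply/nbhs_ballP; exists e => // y [_ h];
  apply: eA.
split => // i j; rewrite (ord1 i); case: (unliftP ord0 j) => [k ->|->].
  by rewrite !rV_consS; exact: h.
by rewrite !rV_cons0; exact: ballxx.
Qed.

Lemma continuous_rV_consl (R : realType) n (x : 'rV[R]_n) :
  continuous (fun a : R => rV_cons (a, x)).
Proof.
move=> a A /nbhs_ballP[e /= e0 eA]; apply/nbhs_ballP; exists e => // b h;
  apply: eA.
split => // i j; rewrite (ord1 i); case: (unliftP ord0 j) => [k ->|->].
  by rewrite !rV_consS; exact: ballxx.
by rewrite !rV_cons0.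
Qed.

Lemma closed_norm_le (R : realType) n (L : R) :
  closed [set x : 'rV[R]_n | `|x| <= L].
Proof.
apply: (@closed_comp _ _ _ [set y : R | y <= L]); last exact: closed_le.
by move=> x _; exact: norm_continuous.
Qed.

Lemma measurable_norm_le (R : realType) n (L : R) :
  measurable [set x : 'rV[R]_n | `|x| <= L].
Proof.
rewrite -[X in measurable X]setCK; apply: measurableC;
  apply: open_rV_measurable.
exact/closed_openC/closed_norm_le.
Qed.

Lemma compact_norm_le (R : realType) n (L : R) :
  compact [set x : 'rV[R]_n | `|x| <= L].
Proof.
apply: bounded_closed_compact; last exact: closed_norm_le.
exists L; split; first exact: num_real.
by move=> y Ly x /= xL; apply: (le_trans xL); exact: ltW.
Qed.

Lemma lebesgue_norm_le_lty (R : realType) n (L : R) :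
  (lebesgue_rV R n [set x : 'rV[R]_n | `|x| <= L]%R < +oo)%E.
Proof.
elim: n => [|n IH] /=.
  by rewrite /dirac/= indicE; case: (_ \in _) => /=; rewrite ltry.
rewrite /lebesgue_step /pushforward.
have -> : @rV_cons R n @^-1` [set x | `|x| <= L] =
    `[-L, L]%classic `*` [set x : 'rV[R]_n | `|x| <= L].
  apply/seteqP; split => -[a x] /=.
    by rewrite norm_rV_cons ge_max => /andP[aL ?]; split => //;
      rewrite in_itv/= -ler_norml.
  by move=> []; rewrite in_itv/= -ler_norml norm_rV_cons ge_max => -> ->.
rewrite product_measure1E//; last exact: measurable_norm_le.
apply: lte_mul_pinfty => //.
rewrite ge0_fin_numE//.
have h : (@lebesgue_measure R (`[-L, L]%classic : set R)%R < +oo)%E.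
  by rewrite lebesgue_measure_itv/=; case: ifP => _;
    rewrite ?ltry// -EFinB ltry.
exact: h.
Qed.

(** Stated with the norm rather than with the closure of a support, as it is
    this form that passes to partial applications and to derivatives. *)
Definition bounded_support (R : realType) n (h : 'rV[R]_n -> R) :=
  exists L, forall x, L < `|x| -> h x = 0.

Lemma integrable_bounded_support (R : realType) n (h : 'rV[R]_n -> R) D :
  measurable D -> continuous h -> bounded_support h ->
  (lebesgue_rV R n).-integrable D (EFin \o h).
Proof.
move=> mD ch [L hL]; apply: (@integrableS _ _ _ _ setT) => //.
set A := [set x : 'rV[R]_n | `|x| <= L].
have mA : measurable A by exact: measurable_norm_le.
have -> : EFin \o h = (EFin \o h) \_ A.
  apply/funext => x; rewrite patchE; case: ifPn => // /negP xA /=.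
  by rewrite hL// ltNge; apply/negP => xL; apply: xA; rewrite inE.
apply/(integrable_mkcond _ mA).
apply: measurable_bounded_integrable => //.
- exact: lebesgue_norm_le_lty.
- exact: continuous_rV_measurable.
- have /compact_bounded[M [Mr MA]] : compact (h @` A).
    apply: continuous_compact; last exact: compact_norm_le.
    exact: continuous_subspaceT.
  by exists M; split => // y My x Ax; apply: (MA _ My); exists x.
Qed.

(** * The integral of a partial derivative *)

Lemma derive_rV_consr (R : realType) n (phi : 'rV[R]_n.+1 -> R) (a : R)
  (x : 'rV[R]_n) j :
  derivable phi (rV_cons (a, x)) (delta_mx 0 (lift ord0 j)) ->
  derivable (fun y : 'rV[R]_n => phi (rV_cons (a, y))) x (delta_mx 0 j) /\
  partial j (fun y : 'rV[R]_n => phi (rV_cons (a, y))) x =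
    partial (lift ord0 j) phi (rV_cons (a, x)).
Proof.
rewrite /derivable /partial /derive /=.
under [X in _ -> (cvg (X @ _) /\ lim (X @ _) = _)]funext
  do rewrite /= rV_cons_addr.
by [].
Qed.

Lemma derive_rV_consl (R : realType) n (phi : 'rV[R]_n.+1 -> R) (a : R)
  (x : 'rV[R]_n) :
  derivable phi (rV_cons (a, x)) (delta_mx 0 ord0) ->
  derivable (fun b : R => phi (rV_cons (b, x))) a 1 /\
  derive1 (fun b : R => phi (rV_cons (b, x))) a = partial ord0 phi
    (rV_cons (a, x)).
Proof.
rewrite derive1E /derivable /partial /derive /=.
under [X in _ -> (cvg (X @ _) /\ lim (X @ _) = _)]funext => h.
  rewrite /= /GRing.scale /= mulr1 rV_cons_addl. over.
by [].
Qed.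

Lemma partial_eq0_near (R : realType) n (phi : 'rV[R]_n -> R) i x :
  (\forall y \near x, phi y = 0) -> partial i phi x = 0.
Proof.
by move=> h; rewrite /partial (@near_eq_derive _ _ _ _ (cst 0)) ?derive_cst.
Qed.

Lemma partial_eq0 (R : realType) n (phi : 'rV[R]_n -> R) i L :
  (forall x, L < `|x| -> phi x = 0) ->
  forall x, L < `|x| -> partial i phi x = 0.
Proof.
move=> hL x xL; apply: partial_eq0_near.
have : nbhs x [set y : 'rV[R]_n | L < `|y|].
  apply: open_nbhs_nbhs; split => //.
  apply: (@open_comp _ _ _ [set y : R | L < y]); last exact: open_gt.
  by move=> y _; exact: norm_continuous.
by apply: filterS => y /= /hL.
Qed.

Lemma partial_bounded_support (R : realType) n (phi : 'rV[R]_n -> R) i :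
  bounded_support phi -> bounded_support (partial i phi).
Proof. by move=> [L hL]; exists L; exact: partial_eq0. Qed.

(** Fubini: along coordinate i the function has compact support and its
    integral vanishes by the fundamental theorem of calculus. By recursion on
    the dimension only the first coordinate needs the latter, the others being
    coordinates of R^n. *)
Lemma integral_partial0 (R : realType) n (phi : 'rV[R]_n -> R) i :
  (forall x, derivable phi x (delta_mx 0 i)) ->
  continuous phi ->
  continuous (partial i phi) -> bounded_support phi ->
  (\int[lebesgue_rV R n]_x (partial i phi x)%:E = 0)%E.
Proof.
elim: n => [|n IH] in phi i *; first by case: i.
move=> dphi cphi cpphi bphi.
have bpphi := partial_bounded_support i bphi.
have iphi := integrable_bounded_support (@measurableT _ _) cpphi bpphi.
have mcons : measurable_fun setT (@rV_cons R n) by exact: measurable_rV_cons.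
have mp : measurable_fun setT (EFin \o partial i phi).
  by apply/measurable_EFinP; exact: continuous_rV_measurable.
have iphi' : (@lebesgue_measure R \x lebesgue_rV R n)%E.-integrable setT
   (EFin \o partial i phi \o @rV_cons R n).
  apply/integrableP; split; first exact: measurableT_comp.
  have /integrableP[_] := iphi; rewrite /= /lebesgue_step.
  rewrite ge0_integral_pushforward//.
  exact: (measurableT_comp (@abse_measurable R setT) mp).
rewrite /= /lebesgue_step (integral_pushforward mcons mp)//.
rewrite preimage_setT.
have [L hL] := bphi.
case: (unliftP ord0 i) => [j ij|i0].
  rewrite -integral12_prod_meas1//; apply: integral0_eq => a _.
  have dphi_j b x : derivable phi (rV_cons (b, x)) (delta_mx 0 (lift ord0 j)).
    by rewrite -ij.
  have e : partial j (fun y => phi (rV_cons (a, y))) =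
           (fun x => partial i phi (rV_cons (a, x))).
    by apply/funext => x; rewrite ij; have [] := derive_rV_consr (dphi_j a x).
  have := IH (fun y => phi (rV_cons (a, y))) j.
  rewrite e; apply.
  - by move=> x; have [] := derive_rV_consr (dphi_j a x).
  - by move=> x; apply: continuous_comp;
    [exact: continuous_rV_consr|exact: cphi].
  - by move=> x; apply: continuous_comp;
    [exact: continuous_rV_consr|exact: cpphi].
  - by exists L => x Lx; apply: hL; rewrite norm_rV_cons lt_max Lx orbT.
rewrite -integral21_prod_meas1//; apply: integral0_eq => x _.
rewrite /fubini_G /=.
have dphi_0 b : derivable phi (rV_cons (b, x)) (delta_mx 0 ord0).
  by rewrite -i0.
pose F b := phi (rV_cons (b, x)).
have dF b : derivable F b 1 by have [] := derive_rV_consl (dphi_0 b).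
have cF : continuous F.
  by move=> b; apply: continuous_comp; [exact: continuous_rV_consl|exact: cphi].
(* K > L makes F vanish at both ends of [-K, K], so its increment is zero. *)
pose K : R := `|L| + 1.
have K0 : 0 < K by rewrite ltr_pwDr.
have LK : L < K by rewrite (le_lt_trans (ler_norm L))// ltrDl.
have FK b : K <= `|b| -> F b = 0.
  by move=> Kb; apply: hL; rewrite norm_rV_cons lt_max (lt_le_trans LK Kb).
have -> : (fun b => (partial i phi (rV_cons (b, x)))%:E) =
   (fun b => (partial i phi (rV_cons (b, x)))%:E) \_ `[- K, K].
  apply/funext => b; rewrite patchE; case: ifPn => // /negP bK.
  have bL : L < `|rV_cons (b, x)|.
    rewrite norm_rV_cons lt_max (lt_le_trans LK)// leNgt; apply/negP => bK'.
    by apply: bK; rewrite inE /= in_itv /= -ler_norml ltW.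
  by rewrite (partial_eq0 i hL bL).
rewrite -integral_mkcond (@continuous_FTC2 _ _ F).
- by rewrite !FK ?subee// ?normrN ger0_norm// ltW.
- by rewrite gtrN.
- apply: continuous_subspaceT => b.
  by apply: continuous_comp; [exact: continuous_rV_consl|exact: cpphi].
- split; first by move=> b _; exact: dF.
  + by apply: cvg_at_right_filter; exact: cF.
  + by apply: cvg_at_left_filter; exact: cF.
- by move=> b _; have [_ ->] := derive_rV_consl (dphi_0 b); rewrite i0.
Qed.

(** * The L^2 inner product *)

Section L2_theory.
Context (R : realType) (d : nat) (Omega : set 'rV[R]_d).
Hypothesis mO : measurable Omega.
Local Notation E := 'rV[R]_d.
Local Notation leb := (lebesgue_rV R d).
Local Notation L2 := (@L2 R d Omega).
Local Notation dot := (@dotL2 R d Omega _ _).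
Local Notation norm := (@normL2 R d Omega _ _).

(** Because |fg| <= f^2 + g^2. *)
Lemma L2_integrableM (f g : E -> R) : L2 f -> L2 g ->
  leb.-integrable Omega (fun x => (f x * g x)%:E).
Proof.
move=> [mf f2] [mg g2].
apply: (le_integrable mO _ _ (integrableD mO f2 g2)).
  by apply/measurable_EFinP; exact: measurable_funM.
move=> x _ /=; rewrite lee_fin normrM [leRHS]ger0_norm ?addr_ge0 ?sqr_ge0//.
rewrite -[f x ^+ 2]real_normK ?num_real// -[g x ^+ 2]real_normK ?num_real//.
have := sqr_ge0 (`|f x| - `|g x|); have := sqr_ge0 (`|f x| + `|g x|).
by move: `|f x| `|g x| => a b; nra.
Qed.

Lemma L2_linear (a : R) (f g : E -> R) : L2 f -> L2 g ->
  L2 (fun x => a * f x + g x).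
Proof.
move=> [mf f2] [mg g2]; split.
  by apply: measurable_funD => //; exact: measurable_funM.
have i1 := integrableD mO (integrableZl mO (2 * a ^+ 2) f2)
  (integrableZl mO 2 g2).
apply: (le_integrable mO _ _ i1).
  apply/measurable_EFinP; apply: measurable_funX; apply: measurable_funD => //.
  exact: measurable_funM.
move=> x _ /=; rewrite lee_fin [leLHS]ger0_norm ?sqr_ge0// [leRHS]ger0_norm;
  last first.
  nra.
by have := sqr_ge0 (a * f x - g x); nra.
Qed.

Lemma L2mx_linear m n (a : R) (F G : E -> 'M[R]_(m, n)) :
  L2mx Omega F -> L2mx Omega G -> L2mx Omega (fun x => a *: F x + G x).
Proof.
move=> hF hG i j; have := L2_linear a (hF i j) (hG i j).
by congr L2; apply/funext => x; rewrite !mxE.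
Qed.

Lemma L2mxB m n (F G : E -> 'M[R]_(m, n)) :
  L2mx Omega F -> L2mx Omega G -> L2mx Omega (fun x => F x - G x).
Proof.
move=> hF hG; have := L2mx_linear (-1) hG hF.
by congr (L2mx Omega _); apply/funext => x; rewrite scaleN1r addrC.
Qed.

Lemma frobC m n (A B : 'M[R]_(m, n)) : frob A B = frob B A.
Proof. by rewrite /frob; under eq_bigr do under eq_bigr do rewrite mulrC. Qed.

Lemma frob_linearl m n (a : R) (A B C : 'M[R]_(m, n)) :
  frob (a *: A + B) C = a * frob A C + frob B C.
Proof.
rewrite /frob mulr_sumr -big_split; apply: eq_bigr => i _ /=.
rewrite mulr_sumr -big_split; apply: eq_bigr => j _ /=.
by rewrite !mxE mulrDl mulrA.
Qed.

Lemma frob_ge0 m n (A : 'M[R]_(m, n)) : 0 <= frob A A.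
Proof. by apply: sumr_ge0 => i _; apply: sumr_ge0 => j _;
  rewrite -expr2 sqr_ge0. Qed.

Lemma integrable_sumR I (s : seq I) (h : I -> E -> R) :
  (forall i, leb.-integrable Omega (EFin \o h i)) ->
  leb.-integrable Omega (EFin \o (fun x => \sum_(i <- s) h i x)).
Proof.
move=> ih; have := integrable_sum mO s (fun i (_ : xpredT i) => ih i).
by congr (integrable _ _ _); apply/funext => x /=; rewrite sumEFin.
Qed.

Lemma Rintegral_sumR I (s : seq I) (h : I -> E -> R) :
  (forall i, leb.-integrable Omega (EFin \o h i)) ->
  \int[leb]_(x in Omega) (\sum_(i <- s) h i x) =
    \sum_(i <- s) \int[leb]_(x in Omega) h i x.
Proof.
move=> ih; elim: s => [|i s IH].
  by under eq_Rintegral do rewrite big_nil;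
    rewrite big_nil /Rintegral integral0.
under eq_Rintegral do rewrite big_cons.
by rewrite RintegralD// ?big_cons ?IH//; exact: integrable_sumR.
Qed.

Lemma frob_integrable m n (F G : E -> 'M[R]_(m, n)) : L2mx Omega F ->
  L2mx Omega G ->
  leb.-integrable Omega (EFin \o (fun x => frob (F x) (G x))).
Proof.
move=> hF hG; apply: integrable_sumR => i; apply: integrable_sumR => j.
exact: L2_integrableM.
Qed.

Lemma dotL2C m n (F G : E -> 'M[R]_(m, n)) : dot F G = dot G F.
Proof. by apply: eq_Rintegral => x _; rewrite frobC. Qed.

Lemma dotL2_linearl m n (a : R) (F G K : E -> 'M[R]_(m, n)) :
  L2mx Omega F -> L2mx Omega G -> L2mx Omega K ->
  dot (fun x => a *: F x + G x) K = a * dot F K + dot G K.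
Proof.
move=> hF hG hK; rewrite /dotL2; under eq_Rintegral do rewrite frob_linearl.
have iF := frob_integrable hF hK; have iG := frob_integrable hG hK.
rewrite RintegralD ?RintegralZl//.
by have := integrableZl mO a iF.
Qed.

Lemma dotL2_linearr m n (a : R) (F G K : E -> 'M[R]_(m, n)) :
  L2mx Omega F -> L2mx Omega G -> L2mx Omega K ->
  dot K (fun x => a *: F x + G x) = a * dot K F + dot K G.
Proof. by move=> hF hG hK; rewrite dotL2C dotL2_linearl// !(dotL2C K). Qed.

Lemma dotL2Bl m n (F G K : E -> 'M[R]_(m, n)) :
  L2mx Omega F -> L2mx Omega G -> L2mx Omega K ->
  dot (fun x => F x - G x) K = dot F K - dot G K.
Proof.
move=> hF hG hK; transitivity (dot (fun x => -1 *: G x + F x) K).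
  by apply: eq_Rintegral => x _; rewrite scaleN1r addrC.
by rewrite dotL2_linearl// mulN1r addrC.
Qed.

Lemma dotL2Br m n (F G K : E -> 'M[R]_(m, n)) :
  L2mx Omega F -> L2mx Omega G -> L2mx Omega K ->
  dot K (fun x => F x - G x) = dot K F - dot K G.
Proof. by move=> hF hG hK; rewrite dotL2C dotL2Bl// !(dotL2C K). Qed.

Lemma dotL2_ge0 m n (F : E -> 'M[R]_(m, n)) : 0 <= dot F F.
Proof. by apply: Rintegral_ge0 => x _; exact: frob_ge0. Qed.

Lemma normL2_ge0 m n (F : E -> 'M[R]_(m, n)) : 0 <= norm F.
Proof. exact: sqrtr_ge0. Qed.

Lemma sqr_normL2 m n (F : E -> 'M[R]_(m, n)) : norm F ^+ 2 = dot F F.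
Proof. by rewrite sqr_sqrtr// dotL2_ge0. Qed.

(** The quadratic polynomial t |-> ||t F + G||^2 is nonnegative. When ||F|| =
    0 it is affine in t, which forces the coefficient (F, G) to vanish. *)
Lemma CauchySchwarz_L2 m n (F G : E -> 'M[R]_(m, n)) :
  L2mx Omega F -> L2mx Omega G -> `|dot F G| <= norm F * norm G.
Proof.
move=> hF hG.
have key t : 0 <= t ^+ 2 * norm F ^+ 2 + 2 * t * dot F G + norm G ^+ 2.
  have hK := L2mx_linear t hF hG.
  have := dotL2_ge0 (fun x => t *: F x + G x).
  rewrite dotL2_linearl// !dotL2_linearr// -!sqr_normL2 (dotL2C G F); nra.
have F0 := normL2_ge0 F; have G0 := normL2_ge0 G.
rewrite -ler_sqr ?nnegrE ?mulr_ge0// real_normK ?num_real// exprMn.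
have [FE|Fn] := eqVneq (norm F) 0.
  move: key; rewrite FE expr0n /= => key.
  have [->|dn] := eqVneq (dot F G) 0; first by rewrite expr0n mul0r.
  (* At this t the affine polynomial takes the value - 1. *)
  have := key (- (norm G ^+ 2 + 1) / (2 * dot F G)).
  have -> : 2 * (- (norm G ^+ 2 + 1) / (2 * dot F G)) * dot F G =
    - (norm G ^+ 2 + 1).
    by field.
  by rewrite mulr0 add0r; lra.
have Fp : 0 < norm F ^+ 2 by rewrite exprn_gt0// lt0r Fn.
(* The vertex of the polynomial is at - (F, G) / ||F||^2. *)
have := key (- dot F G / norm F ^+ 2).
have -> : (- dot F G / norm F ^+ 2) ^+ 2 * norm F ^+ 2 +
  2 * (- dot F G / norm F ^+ 2) * dot F G + norm G ^+ 2
  = (norm F ^+ 2 * norm G ^+ 2 - dot F G ^+ 2) / norm F ^+ 2 by field.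
by rewrite pmulr_lge0 ?invr_gt0// subr_ge0.
Qed.

Lemma normL2_linear_le m n (a : R) (F G : E -> 'M[R]_(m, n)) :
  L2mx Omega F -> L2mx Omega G ->
  norm (fun x => a *: F x + G x) <= `|a| * norm F + norm G.
Proof.
move=> hF hG; have hK := L2mx_linear a hF hG.
have F0 := normL2_ge0 F; have G0 := normL2_ge0 G.
rewrite -ler_sqr ?nnegrE ?addr_ge0 ?mulr_ge0 ?normL2_ge0// sqr_normL2.
rewrite dotL2_linearl// !dotL2_linearr// -!sqr_normL2 (dotL2C G F).
rewrite sqrrD exprMn real_normK ?num_real//.
have h : a * dot F G <= `|a| * norm F * norm G.
  apply: (le_trans (ler_norm _)); rewrite normrM -mulrA ler_wpM2l//.
  exact: CauchySchwarz_L2.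
by move: h; lra.
Qed.

End L2_theory.

(** * Test functions *)

Lemma class_CW (R : realType) d k (f : 'rV[R]_d -> R) : class_C k.+1 f ->
  class_C k f.
Proof.
elim: k f => [|k IH] f; first by move=> [].
by move=> [cf df pf]; split=> // i; exact/IH/pf.
Qed.

Lemma partial_linear (R : realType) d (a : R) (f g : 'rV[R]_d -> R) i x :
  derivable f x (delta_mx 0 i) -> derivable g x (delta_mx 0 i) ->
  derivable (fun x => a * f x + g x) x (delta_mx 0 i) /\
  partial i (fun x => a * f x + g x) x = a * partial i f x + partial i g x.
Proof.
move=> df dg; have daf := @derivableZ _ _ _ f a _ _ df.
split; first exact: (derivableD daf dg).
by rewrite /partial (deriveD daf dg) deriveZ.
Qed.

Lemma partialM (R : realType) d (f g : 'rV[R]_d -> R) i x :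
  derivable f x (delta_mx 0 i) -> derivable g x (delta_mx 0 i) ->
  derivable (fun x => f x * g x) x (delta_mx 0 i) /\
  partial i (fun x => f x * g x) x = f x * partial i g x + g x * partial i f x.
Proof.
move=> df dg; split; first exact: (derivableM df dg).
by rewrite /partial (deriveM df dg).
Qed.

Lemma continuous_linear (R : realType) d (a : R) (f g : 'rV[R]_d -> R) :
  continuous f -> continuous g -> continuous (fun x => a * f x + g x).
Proof.
by move=> cf cg x; exact: (cvgD (cvgM (cvg_cst a) (cf x)) (cg x)).
Qed.

Lemma class_C_linear (R : realType) d k (a : R) (f g : 'rV[R]_d -> R) :
  class_C k f -> class_C k g -> class_C k (fun x => a * f x + g x).
Proof.
elim: k f g => [|k IH] f g; first exact: continuous_linear.
move=> [cf df pf] [cg dg pg]; split.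
- exact: continuous_linear.
- by move=> i x; have [] := partial_linear a (df i x) (dg i x).
- move=> i; have -> : partial i (fun x => a * f x + g x) =
     (fun x => a * partial i f x + partial i g x).
    by apply/funext => x; have [] := partial_linear a (df i x) (dg i x).
  exact: (IH _ _ (pf i) (pg i)).
Qed.

Lemma class_C_mul (R : realType) d k (f g : 'rV[R]_d -> R) :
  class_C k f -> class_C k g -> class_C k (fun x => f x * g x).
Proof.
elim: k f g => [|k IH] f g; first by move=> cf cg x;
  exact: (cvgM (cf x) (cg x)).
move=> hf hg; have [cf df pf] := hf; have [cg dg pg] := hg; split.
- by move=> x; exact: (cvgM (cf x) (cg x)).
- by move=> i x; have [] := partialM (df i x) (dg i x).
- move=> i; have -> : partial i (fun x => f x * g x) =
     (fun x => 1 * (f x * partial i g x) + g x * partial i f x).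
    by apply/funext => x; rewrite mul1r; have [] := partialM (df i x) (dg i x).
  apply: class_C_linear; first exact: (IH _ _ (class_CW hf) (pg i)).
  exact: (IH _ _ (class_CW hg) (pf i)).
Qed.

Section test_functions.
Context (R : realType) (d : nat) (Omega : set 'rV[R]_d).
Hypothesis oO : open Omega.
Local Notation E := 'rV[R]_d.
Local Notation leb := (lebesgue_rV R d).
Local Notation test := (test_function Omega).
Let mO : measurable Omega := open_rV_measurable oO.

Lemma test_supportW (psi : E -> R) (A : set E) :
  [set x | psi x != 0] `<=` A -> compact (closure A) -> closure A `<=` Omega ->
  smooth psi -> test psi.
Proof.
move=> sA cA AO spsi; have := closureS sA => sA'; split => //.
  by apply: subclosed_compact sA' => //; exact: closed_closure.
exact: subset_trans AO.
Qed.

Lemma test_linear (a : R) (f g : E -> R) :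
  test f -> test g -> test (fun x => a * f x + g x).
Proof.
move=> [sf cf fO] [sg cg gO].
apply: (@test_supportW _ ([set x | f x != 0] `|` [set x | g x != 0])).
- move=> x /=; have [->|] := eqVneq (f x) 0; last by left.
  by rewrite mulr0 add0r; right.
- by rewrite closureU; exact: compactU.
- by rewrite closureU => x []; [exact: fO|exact: gO].
- by move=> k; apply: class_C_linear.
Qed.

Lemma test_mul (f g : E -> R) : test f -> test g -> test (fun x => f x * g x).
Proof.
move=> [sf cf fO] [sg cg gO].
apply: (@test_supportW _ [set x | f x != 0]) => //.
- by move=> x /=; rewrite mulf_eq0 negb_or => /andP[].
- by move=> k; apply: class_C_mul.
Qed.

Lemma test_derivable f i x : test f -> derivable f x (delta_mx 0 i : E).
Proof. by move=> [sf _ _]; have [_ h _] := sf 1%N; exact: h. Qed.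

Lemma test_continuous f : test f -> continuous f.
Proof. by move=> [sf _ _]; exact: (sf 0%N). Qed.

Lemma test_partial_continuous f i : test f -> continuous (partial i f).
Proof. by move=> [sf _ _]; have [_ _ h] := sf 1%N; exact: h. Qed.

Lemma test_bounded_support f : test f -> bounded_support f.
Proof.
move=> [_ /compact_bounded[M [_ hM]] _]; exists (M + 1) => x xM.
have [//|fx] := eqVneq (f x) 0.
have cx : closure [set x | f x != 0] x by exact: subset_closure.
have := hM (M + 1); rewrite ltrDl => /(_ ltr01 x cx).
by move=> /(lt_le_trans xM); rewrite ltxx.
Qed.

(** Off Omega, hence off the closed support, the function vanishes in a whole
    neighbourhood. This lets integrals over Omega be replaced by integrals
    over R^n. *)
Lemma test_partial_out f i x : test f -> ~ Omega x -> partial i f x = 0.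
Proof.
move=> [_ _ fO] xO; apply: partial_eq0_near.
have : nbhs x (~` closure [set x | f x != 0]).
  apply: open_nbhs_nbhs; split; first exact/closed_openC/closed_closure.
  by move=> /fO.
by apply: filterS => y /= h; apply/eqP/negPn/negP => fy; apply: h;
  exact: subset_closure.
Qed.

Lemma L2_bounded_support (f : E -> R) : continuous f -> bounded_support f ->
  L2 Omega f.
Proof.
move=> cf [L fL]; split; first exact: continuous_rV_measurable.
apply: (@integrable_bounded_support R d (fun x => f x ^+ 2)) => //.
  by move=> x; exact: (cvgM (cf x) (cf x)).
by exists L => x /fL ->; rewrite expr0n.
Qed.

Lemma test_L2 f : test f -> L2 Omega f.
Proof. by move=> tf; apply: L2_bounded_support;
  [exact: test_continuous|exact: test_bounded_support]. Qed.

Lemma test_partial_L2 f i : test f -> L2 Omega (partial i f).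
Proof.
move=> tf; apply: L2_bounded_support; first exact: test_partial_continuous.
exact/partial_bounded_support/test_bounded_support.
Qed.

Lemma test_partial_integrable f i : test f -> leb.-integrable Omega
  (EFin \o partial i f).
Proof.
move=> tf; apply: integrable_bounded_support => //;
  first exact: test_partial_continuous.
exact/partial_bounded_support/test_bounded_support.
Qed.

Lemma integral_test_partial f i : test f ->
  (\int[leb]_(x in Omega) (partial i f x)%:E = 0)%E.
Proof.
move=> tf; rewrite -[RHS](@integral_partial0 R d f i).
- rewrite integral_mkcond; apply: eq_integral => x _; rewrite patchE.
  by case: ifPn => // /negP xO; rewrite test_partial_out// => Ox; apply: xO;
    rewrite inE.
- by move=> x; exact: test_derivable.
- exact: test_continuous.
- exact: test_partial_continuous.
- exact: test_bounded_support.
Qed.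

(** The product f g is again a test function, so the integral of its
    derivative vanishes. *)
Lemma test_by_parts f g i : test f -> test g ->
  \int[leb]_(x in Omega) (f x * partial i g x) =
  - \int[leb]_(x in Omega) (partial i f x * g x).
Proof.
move=> tf tg; apply/eqP; rewrite -addr_eq0 -RintegralD//.
- apply/eqP; rewrite -[RHS](congr1 fine (integral_test_partial i
  (test_mul tf tg))).
  apply: eq_Rintegral => x _.
  have [_ ->] := partialM (@test_derivable f i x tf) (@test_derivable g i x tg).
  by rewrite [partial i f x * _]mulrC.
- exact: (L2_integrableM mO (test_L2 tf) (test_partial_L2 i tg)).
- exact: (L2_integrableM mO (test_partial_L2 i tf) (test_L2 tg)).
Qed.

End test_functions.

(** * Linearity of the spaces X and V *)

Section fields.
Context (R : realType) (d : nat) (Omega : set 'rV[R]_d).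
Hypothesis oO : open Omega.
Local Notation E := 'rV[R]_d.
Local Notation leb := (lebesgue_rV R d).
Local Notation dot := (@dotL2 R d Omega _ _).
Local Notation norm := (@normL2 R d Omega _ _).
Local Notation X := (inX Omega).
Local Notation V := (inV Omega).
Let mO : measurable Omega := open_rV_measurable oO.

Lemma Rintegral_linear a (f g : E -> R) :
  leb.-integrable Omega (EFin \o f) -> leb.-integrable Omega (EFin \o g) ->
  \int[leb]_(x in Omega) (a * f x + g x) =
  a * \int[leb]_(x in Omega) f x + \int[leb]_(x in Omega) g x.
Proof.
move=> jf jg; rewrite RintegralD ?RintegralZl//.
by have := integrableZl mO a jf.
Qed.

Lemma inX_L2_grad v : X v -> L2mx Omega v.2.
Proof. by move=> [[]]. Qed.

Lemma L2mx_test (phi : E -> E) :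
  (forall j, test_function Omega (fun x => phi x 0 j)) ->
  L2mx Omega phi.
Proof. by move=> tphi i j; rewrite (ord1 i); exact: test_L2. Qed.

Lemma L2mx_grad_test (phi : E -> E) :
  (forall j, test_function Omega (fun x => phi x 0 j)) ->
  L2mx Omega (grad phi).
Proof.
move=> tphi i j; have := test_partial_L2 oO i (tphi j).
by congr (L2 Omega _); apply/funext => x; rewrite mxE.
Qed.

Lemma grad_linear a (phi psi : E -> E) x :
  (forall j, test_function Omega (fun x => phi x 0 j)) ->
  (forall j, test_function Omega (fun x => psi x 0 j)) ->
  grad (fun x => a *: phi x + psi x) x = a *: grad phi x + grad psi x.
Proof.
move=> tphi tpsi; apply/matrixP => i j; rewrite !mxE.
have [_ <-] := partial_linear a (@test_derivable _ _ _ _ i x (tphi j))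
  (@test_derivable _ _ _ _ i x (tpsi j)).
by congr (partial i _ x); apply/funext => y; rewrite !mxE.
Qed.

(** Needed twice to see that a combination of H^1-limits of test fields is
    one: for the fields and for their gradients. *)
Lemma cvg_normL2_linear a m n (F G : nat -> E -> 'M[R]_(m, n))
  (F0 G0 : E -> 'M[R]_(m, n)) :
  (forall k, L2mx Omega (F k)) -> (forall k, L2mx Omega (G k)) ->
  L2mx Omega F0 -> L2mx Omega G0 ->
  (fun k => norm (fun x => F k x - F0 x)) @ \oo --> (0 : R) ->
  (fun k => norm (fun x => G k x - G0 x)) @ \oo --> (0 : R) ->
  (fun k => norm (fun x => a *: F k x + G k x - (a *: F0 x + G0 x))) @ \oo -->
    (0 : R).
Proof.
move=> hF hG hF0 hG0 cF cG.
apply: (@squeeze_cvgr _ _ _ _ (cst 0)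
  (fun k => `|a| * norm (fun x => F k x - F0 x)
             + norm (fun x => G k x - G0 x))).
- apply: nearW => k; rewrite /= normL2_ge0 /=.
  have -> : (fun x => a *: F k x + G k x - (a *: F0 x + G0 x)) =
    (fun x => a *: (F k x - F0 x) + (G k x - G0 x)).
    by apply/funext => x; rewrite scalerBr opprD addrACA.
  by apply: normL2_linear_le => //; exact: L2mxB.
- exact: cvg_cst.
- rewrite -[X in _ --> X](addr0 0) -[X in _ --> X + _](mulr0 `|a|).
  by apply: cvgD => //; apply: cvgM => //; exact: cvg_cst.
Qed.

Lemma inX_linear a v w : X v -> X w -> X (a *: v + w).
Proof.
move=> hv hw; have [[v1 v2 wv] [phi [tphi c1 c2]]] := hv.
have [[w1 w2 ww] [psi [tpsi e1 e2]]] := hw.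
split; first split.
- exact: (L2mx_linear mO a v1 w1).
- exact: (L2mx_linear mO a v2 w2).
- move=> i j f tf.
  transitivity (\int[leb]_(x in Omega)
     (a * (v.1 x 0 j * partial i f x) + w.1 x 0 j * partial i f x)).
    by apply: eq_Rintegral => x _; rewrite /= !mxE mulrDl mulrA.
  transitivity (- \int[leb]_(x in Omega)
     (a * (v.2 x i j * f x) + w.2 x i j * f x)); last first.
    by congr (- _); apply: eq_Rintegral => x _; rewrite /= !mxE mulrDl mulrA.
  have tf2 := test_L2 oO tf; have tpf2 := test_partial_L2 oO i tf.
  rewrite !Rintegral_linear ?(wv i j f tf) ?(ww i j f tf); last 4 first.
  - exact: (L2_integrableM mO (v2 i j) tf2).
  - exact: (L2_integrableM mO (w2 i j) tf2).
  - exact: (L2_integrableM mO (v1 0 j) tpf2).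
  - exact: (L2_integrableM mO (w1 0 j) tpf2).
  by rewrite opprD mulrN.
exists (fun n x => a *: phi n x + psi n x); split.
- move=> n j; have := test_linear a (tphi n j) (tpsi n j).
  by congr (test_function _ _); apply/funext => x; rewrite !mxE.
- by apply: cvg_normL2_linear => // k; exact: L2mx_test.
- have := cvg_normL2_linear a (fun k => L2mx_grad_test (tphi k))
    (fun k => L2mx_grad_test (tpsi k)) v2 w2 c2 e2.
  congr (_ @ \oo --> (0 : R)); apply/funext => k; congr (norm _);
    apply/funext => x.
  by rewrite grad_linear.
Qed.

Lemma inV_inX v : V v -> X v.
Proof. by case. Qed.

Lemma L2_sum I (s : seq I) (h : I -> E -> R) : (forall i, L2 Omega (h i)) ->
  L2 Omega (fun x => \sum_(i <- s) h i x).
Proof.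
move=> hh; elim: s => [|i s IH].
  under eq_fun do rewrite big_nil; split; first exact: measurable_cst.
  by rewrite expr0n; exact: integrable0.
have := L2_linear mO 1 (hh i) IH.
by congr (L2 Omega _); apply/funext => x; rewrite big_cons mul1r.
Qed.

Lemma L2_tr m (F : E -> 'M[R]_m) :
  L2mx Omega F -> L2 Omega (fun x => \tr (F x)).
Proof. by move=> hF; apply: L2_sum. Qed.

Lemma inV_linear a v w : V v -> V w -> V (a *: v + w).
Proof.
move=> [hv dv] [hw dw]; split; first exact: inX_linear.
move=> q hq; have [q2 _] := hq.
transitivity (\int[leb]_(x in Omega)
    (a * (\tr (v.2 x) * q x) + \tr (w.2 x) * q x)).
  by apply: eq_Rintegral => x _; rewrite /= linearP /= mulrDl mulrA.
rewrite Rintegral_linear ?dv ?dw ?mulr0 ?addr0//.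
- exact: (L2_integrableM mO (L2_tr (inX_L2_grad hv)) q2).
- exact: (L2_integrableM mO (L2_tr (inX_L2_grad hw)) q2).
Qed.

Lemma normL20 m n : norm (fun _ => 0 : 'M[R]_(m, n)) = 0.
Proof.
rewrite /normL2 /dotL2; under eq_Rintegral.
  move=> x _; rewrite /frob big1; last first.
    by move=> i _; rewrite big1// => j _; rewrite mxE mul0r.
  over.
by rewrite /Rintegral integral0 sqrtr0.
Qed.

(** Smooth compactly supported fields, paired with their classical gradients,
    are thus legitimate arguments of the bounds on the convection form. *)
Lemma inX_test (phi : E -> E) :
  (forall j, test_function Omega (fun x => phi x 0 j)) ->
  X (phi, grad phi).
Proof.
move=> tphi; split; first split.
- exact: L2mx_test.
- exact: L2mx_grad_test.
- move=> i j f tf; rewrite /= (test_by_parts oO i (tphi j) tf); congr (- _).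
  by apply: eq_Rintegral => x _; rewrite mxE.
exists (fun _ => phi); split => //.
- under eq_fun do (under [fun x => _]eq_fun do rewrite /= subrr).
  by rewrite normL20; exact: cvg_cst.
- under eq_fun do (under [fun x => _]eq_fun do rewrite /= subrr).
  by rewrite normL20; exact: cvg_cst.
Qed.

End fields.

(** * Skew-symmetry of the convection form *)

Lemma eq0_le_cvg0 (R : realType) (x : R) (g : nat -> R) :
  (forall n, `|x| <= g n) -> g @ \oo --> (0 : R) -> x = 0.
Proof.
move=> xg g0; apply/normr0_eq0/le_anti; rewrite normr_ge0 andbT.
rewrite -(cvg_lim _ g0)//; apply: limr_ge; first by apply/cvg_ex; exists 0.
exact: nearW.
Qed.

Section skew.
Context (R : realType) (d : nat) (Omega : set 'rV[R]_d).
Hypothesis oO : open Omega.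
Local Notation E := 'rV[R]_d.
Local Notation leb := (lebesgue_rV R d).
Local Notation dot := (@dotL2 R d Omega _ _).
Local Notation norm := (@normL2 R d Omega _ _).
Local Notation X := (inX Omega).
Local Notation V := (inV Omega).
Let mO : measurable Omega := open_rV_measurable oO.

(** The mean of a divergence of a test field is zero because each partial
    derivative integrates to zero, also when Omega has infinite measure. *)
Lemma inQ_div_test (phi : E -> E) :
  (forall j, test_function Omega (fun x => phi x 0 j)) ->
  inQ Omega (fun x => \tr (grad phi x)).
Proof.
move=> tphi; split; first by apply: (L2_tr oO); exact: (L2mx_grad_test oO tphi).
have ii (i : 'I_d) : leb.-integrable Omega (EFin \o (fun x => grad phi x i i)).
  have := test_partial_integrable oO i (tphi i).
  by congr (integrable _ _ _); apply/funext => x /=; rewrite mxE.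
have itr := integrable_sumR mO (index_enum 'I_d) ii.
rewrite -[LHS]fineK; last exact: (integrable_fin_num mO itr).
congr EFin; rewrite [LHS](Rintegral_sumR mO (index_enum 'I_d) ii).
rewrite big1// => i _;
  rewrite -[RHS](congr1 fine (integral_test_partial i (tphi i))).
by apply: eq_Rintegral => x _; rewrite mxE.
Qed.

Lemma frob_scalar m (a : R) (A : 'M[R]_m) : frob a%:M A = a * \tr A.
Proof.
rewrite /frob /mxtrace mulr_sumr; apply: eq_bigr => i _.
rewrite (bigD1 i)//= big1 ?addr0; first by rewrite mxE eqxx.
by move=> j ji; rewrite mxE eq_sym (negbTE ji) mul0r.
Qed.

Lemma L2mx_scalar m (f : E -> R) :
  L2 Omega f -> L2mx Omega (fun x => (f x)%:M : 'M[R]_m).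
Proof.
move=> hf i j; have [->|ij] := eqVneq i j.
  by have := hf; congr L2; apply/funext => x; rewrite mxE eqxx.
have := L2_linear mO (-1) hf hf.
by congr L2; apply/funext => x; rewrite mxE (negbTE ij) mulN1r addNr.
Qed.

(** The definition of V only tests div u against functions of mean zero. With
    test fields phi_n converging to u in H^1, the functions div phi_n are
    such, hence the integral of div u div phi_n is 0 for all n, and in the
    limit that of (div u)^2 is 0. The constant mode that Q leaves out is
    thereby excluded through the boundary condition on u. *)
Lemma inV_divergence_free u (q : E -> R) : V u -> L2 Omega q ->
  \int[leb]_(x in Omega) (\tr (u.2 x) * q x) = 0.
Proof.
move=> [Xu du] hq; have [[u1 u2 _] [phi [tphi _ cphi]]] := Xu.
have t2 : L2 Omega (fun x => \tr (u.2 x)) by exact: (L2_tr oO).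
pose P x : 'M[R]_d := (\tr (u.2 x))%:M.
have hP : L2mx Omega P by exact: L2mx_scalar.
have PuE : dot P u.2 = 0.
  apply: (@eq0_le_cvg0 _ _
    (fun n => norm P * norm (fun x => grad (phi n) x - u.2 x))).
    move=> n; have hg := L2mx_grad_test oO (tphi n).
    have -> : dot P u.2 = - dot P (fun x => grad (phi n) x - u.2 x).
      rewrite (dotL2Br mO)// (_ : dot P (grad (phi n)) = 0) ?sub0r ?opprK//.
      rewrite -[RHS](du _ (inQ_div_test (tphi n))).
      by apply: eq_Rintegral => x _; rewrite frob_scalar.
    by rewrite normrN; apply: (CauchySchwarz_L2 mO) => //; exact: (L2mxB mO).
  rewrite -[X in _ --> X](mulr0 (norm P)).
  by apply: cvgM => //; exact: cvg_cst.
pose T x : 'M[R]_1 := (\tr (u.2 x))%:M; pose S x : 'M[R]_1 := (q x)%:M.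
have hT : L2mx Omega T by exact: L2mx_scalar.
have hS : L2mx Omega S by exact: L2mx_scalar.
have T0 : norm T = 0.
  rewrite /normL2 -[RHS]sqrtr0 -PuE; congr Num.sqrt.
  by apply: eq_Rintegral => x _; rewrite !frob_scalar mxtrace_scalar.
have := CauchySchwarz_L2 mO hT hS; rewrite T0 mul0r normr_le0 => /eqP <-.
by apply: eq_Rintegral => x _; rewrite frob_scalar mxtrace_scalar.
Qed.

Variable M : R.
Hypothesis hM : trilinear_bounds Omega M.

Lemma trilin_integrable u w v : X u -> X w -> X v ->
  leb.-integrable Omega (EFin \o (fun x => frob (convection u w x) (v.1 x))).
Proof. by move=> hu hw hv; have [] := hM hu hw hv. Qed.

Lemma trilin_linear3 a u w v1 v2 : X u -> X w -> X v1 -> X v2 ->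
  trilin Omega u w (a *: v1 + v2) =
  a * trilin Omega u w v1 + trilin Omega u w v2.
Proof.
move=> hu hw h1 h2; rewrite /trilin /dotL2 -(Rintegral_linear oO); last 2 first.
- exact: trilin_integrable.
- exact: trilin_integrable.
apply: eq_Rintegral => x _; rewrite frobC /= frob_linearl.
by rewrite frobC (frobC (v2.1 x)).
Qed.

Lemma trilin_linear2 a u w1 w2 v : X u -> X w1 -> X w2 -> X v ->
  trilin Omega u (a *: w1 + w2) v =
  a * trilin Omega u w1 v + trilin Omega u w2 v.
Proof.
move=> hu h1 h2 hv; rewrite /trilin /dotL2 -(Rintegral_linear oO); last 2 first.
- exact: trilin_integrable.
- exact: trilin_integrable.
apply: eq_Rintegral => x _; rewrite -frob_linearl; congr frob.
by rewrite /convection /= mulmxDr -scalemxAr.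
Qed.

(** X is so far known to be stable under the operations a v + w only, and - v
    is (-2) v + v. *)
Lemma inXN v : X v -> X (- v).
Proof.
move=> hv; have -> : - v = (- 2) *: v + v.
  by rewrite scaleNr scaler_nat mulr2n opprD addrNK.
exact: inX_linear.
Qed.

(** The assumed bound is one-sided; applying it to v and to - v bounds the
    absolute value. *)
Lemma trilin_abs_le u w v : X u -> X w -> X v ->
  `|trilin Omega u w v| <= M * norm u.2 * norm w.2 * norm v.2.
Proof.
move=> hu hw hv; rewrite ler_norml lerNl; apply/andP; split;
  last by have [] := hM hu hw hv.
have [_ _] := hM hu hw (inXN hv).
have -> : norm (- v).2 = norm v.2.
  congr Num.sqrt; apply: eq_Rintegral => x _; apply: eq_bigr => i _;
    apply: eq_bigr => j _.
  by rewrite /= !mxE mulrNN.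
have -> : - v = (- 2) *: v + v.
  by rewrite scaleNr scaler_nat mulr2n opprD addrNK.
by rewrite trilin_linear3//; lra.
Qed.

(** For a test field, u . (grad phi) phi = u . grad (|phi|^2 / 2), and moving
    the gradient onto u leaves the integral of div u |phi|^2 / 2, which is
    zero. Everything is done componentwise: each (phi_j)^2 is a test function
    for the weak gradient of u. *)
Lemma trilin_test u (phi : E -> E) : V u ->
  (forall j, test_function Omega (fun x => phi x 0 j)) ->
  trilin Omega u (phi, grad phi) (phi, grad phi) = 0.
Proof.
move=> Vu tphi; have [Xu _] := Vu; have [[u1 u2 wu] _] := Xu.
pose f j x := phi x 0 j.
have tff j : test_function Omega (fun x => f j x * f j x)
  by exact: (test_mul (tphi j) (tphi j)).
have ipart j k : leb.-integrable Omega
   (EFin \o (fun x => u.1 x 0 k * partial k (fun x => f j x * f j x) x)).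
  exact: (L2_integrableM mO (u1 0 k) (test_partial_L2 oO k (tff j))).
(* f_j d_k f_j is half of the derivative of f_j ^ 2. *)
transitivity (\int[leb]_(x in Omega) (\sum_j \sum_k
    2^-1 * (u.1 x 0 k * partial k (fun x => f j x * f j x) x))).
  apply: eq_Rintegral => x _; rewrite /frob big_ord1; apply: eq_bigr => j _.
  rewrite mxE mulr_suml; apply: eq_bigr => k _ /=; rewrite mxE.
  have [_ ->] := partialM (@test_derivable _ _ _ _ k x (tphi j))
    (@test_derivable _ _ _ _ k x (tphi j)).
  by rewrite /f; field.
have iz j k : leb.-integrable Omega
    (EFin \o (fun x => 2^-1 * (u.1 x 0 k * partial k (fun x =>
      f j x * f j x) x))).
  exact: (integrableZl mO 2^-1 (ipart j k)).
rewrite (Rintegral_sumR mO); last by move=> j; apply: (integrable_sumR mO) => k;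
  exact: iz.
rewrite big1// => j _; rewrite (Rintegral_sumR mO); last exact: iz.
under eq_bigr => k _ do rewrite (RintegralZl _ mO (ipart j k))
  (wu k k _ (tff j)).
rewrite -mulr_sumr sumrN -(Rintegral_sumR mO); last first.
  by move=> k; exact: (L2_integrableM mO (u2 k k) (test_L2 oO (tff j))).
under eq_Rintegral do rewrite -mulr_suml.
by rewrite (inV_divergence_free Vu (test_L2 oO (tff j))) oppr0 mulr0.
Qed.

(** Test fields Phi_n converge to v in H^1 and b(u, Phi_n, Phi_n) = 0. Writing
    Phi_n = v + D, the error b(u, v, v) - b(u, Phi_n, Phi_n) is bounded by
    terms that contain ||grad D||, which tends to 0. *)
Lemma trilin_skew u v : V u -> X v -> trilin Omega u v v = 0.
Proof.
move=> Vu hv; have [hu _] := Vu.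
have [[v1 v2 _] [phi [tphi _ cphi]]] := hv.
pose e n := norm (fun x => grad (phi n) x - v.2 x).
pose C := M * norm u.2.
apply: (@eq0_le_cvg0 _ _ (fun n => C * norm v.2 * e n + C * e n * norm v.2 +
  C * e n * e n)).
  move=> n.
  have : X (phi n, grad (phi n)) by exact: inX_test.
  have : norm (fun x => (phi n, grad (phi n)).2 x - v.2 x) = e n by [].
  have := trilin_test Vu (tphi n).
  move: (phi n, grad (phi n)) => Phi Phi0 ePhi hPhi.
  have [D DE] : exists D, D = -1 *: v + Phi by exists (-1 *: v + Phi).
  have hD : X D by rewrite DE; exact: inX_linear.
  have eE : norm D.2 = e n.
    by rewrite -ePhi DE; congr (norm _); apply/funext => x;
      rewrite /= scaleN1r addrC.
  have PhiE : Phi = 1 *: v + D by rewrite DE scale1r scaleN1r addrA subrr add0r.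
  move: Phi0; rewrite PhiE.
  have hvD : X (1 *: v + D) by exact: inX_linear.
  rewrite (trilin_linear3 1 hu hvD hv hD).
  rewrite (trilin_linear2 1 hu hv hD hv) (trilin_linear2 1 hu hv hD hD).
  rewrite !mul1r => h.
  have {h}-> : trilin Omega u v v = - (trilin Omega u v D + trilin Omega u D v +
    trilin Omega u D D).
    by lra.
  rewrite normrN -eE; apply: (le_trans (ler_normD _ _)); apply: lerD.
    by apply: (le_trans (ler_normD _ _)); apply: lerD; exact: trilin_abs_le.
  exact: trilin_abs_le.
have cst c : (fun _ : nat => c : R) @ \oo --> c by exact: cvg_cst.
have z : 0 = C * norm v.2 * 0 + C * 0 * norm v.2 + C * 0 * 0 :> R
  by rewrite !(mulr0, mul0r) !addr0.
rewrite [X in _ --> X]z; apply: cvgD; first apply: cvgD.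
- exact: cvgM.
- by apply: cvgM => //; exact: cvgM.
- by apply: cvgM => //; exact: cvgM.
Qed.

End skew.

(** * A priori bounds *)

Section estimates.
Context (R : realType) (d : nat) (Omega : set 'rV[R]_d).
Hypothesis oO : open Omega.
Local Notation E := 'rV[R]_d.
Local Notation leb := (lebesgue_rV R d).
Local Notation dot := (@dotL2 R d Omega _ _).
Local Notation norm := (@normL2 R d Omega _ _).
Local Notation X := (inX Omega).
Local Notation V := (inV Omega).
Let mO : measurable Omega := open_rV_measurable oO.
Variable f : vfield R d -> R.
Hypothesis hf : inHm1 Omega f.
Local Notation F := (normHm1 Omega f).

Let dual_set := [set `|f v| / norm v.2 | v in [set v | X v /\ norm v.2 != 0]].

Let dual_set_ub : has_ubound dual_set.
Proof.
have [_ [C hC]] := hf; exists C => _ [v [hv vn] <-].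
by rewrite ler_pdivrMr ?hC// lt0r vn normL2_ge0.
Qed.

Lemma normHm1_ge0 : 0 <= F.
Proof.
have [e|/set0P[y yd]] := eqVneq dual_set set0; rewrite /normHm1 -/dual_set.
  by rewrite e sup0.
have y0 : 0 <= y by case: yd => v _ <-; rewrite divr_ge0 ?normL2_ge0.
by apply: (le_trans y0); exact: ub_le_sup.
Qed.

(** When ||grad v|| = 0 the quotient defining the dual norm says nothing, but
    continuity of f gives f v = 0. *)
Lemma Hm1_bound v : X v -> `|f v| <= F * norm v.2.
Proof.
move=> hv; have [vn|vn] := eqVneq (norm v.2) 0.
  by have [_ [C /(_ v hv)]] := hf; rewrite vn !mulr0.
rewrite -ler_pdivrMr ?lt0r ?vn ?normL2_ge0//.
by apply: ub_le_sup => //; exists v.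
Qed.

Variables (M : R) (nu : R).
Hypothesis hM : trilinear_bounds Omega M.
Hypothesis nu0 : 0 < nu.

(** Test with v = u: the convection term vanishes. *)
Lemma steady_NS_bound u : steady_NS Omega nu f u -> norm u.2 <= nu^-1 * F.
Proof.
move=> [Vu /(_ u Vu)]; rewrite (trilin_skew oO hM Vu (inV_inX Vu)) addr0 => e.
have [->|un] := eqVneq (norm u.2) 0.
  by rewrite mulr_ge0 ?invr_ge0 ?normHm1_ge0// ltW.
have up : 0 < norm u.2 by rewrite lt0r un normL2_ge0.
have := le_trans (ler_norm _) (Hm1_bound (inV_inX Vu)).
by rewrite -e -sqr_normL2 expr2 mulrA ler_pM2r// ler_pdivlMl.
Qed.

(** Linearity of I_H holds almost everywhere on Omega, so the integral equals
    that of |I_H v - I_H w|^2. *)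
Lemma interpolation_dot_ge0 H C_I I_H v w :
  coarse_interpolation Omega H C_I I_H ->
  X v -> X w ->
  0 <= dot (fun x => I_H v.1 x - I_H w.1 x) (I_H (v - w).1).
Proof.
move=> [lin hL2 _ _] hv hw.
have hvw : X (v - w) by rewrite addrC -scaleN1r; exact: inX_linear.
have h1 := L2mxB mO (hL2 _ hv) (hL2 _ hw).
suff -> : dot (fun x => I_H v.1 x - I_H w.1 x) (I_H (v - w).1) =
  dot (fun x => I_H v.1 x - I_H w.1 x) (fun x => I_H v.1 x - I_H w.1 x).
  exact: dotL2_ge0.
congr fine; apply: ae_eq_integral => //.
- by have /integrableP[] := frob_integrable mO h1 (hL2 _ hvw).
- by have /integrableP[] := frob_integrable mO h1 h1.
have := lin (-1) w v hw hv; apply: filterS => x h Ox.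
congr (frob _ _)%:E.
have -> : (v - w).1 = -1 *: w.1 + v.1 by rewrite scaleN1r addrC.
by rewrite (h Ox) scaleN1r addrC.
Qed.

(** Test with a - w, for which the nudging term is nonnegative. By
    skew-symmetry the convection term is - b(uk, a, w), and (grad a, grad (a -
    w)) is half of ||grad a||^2 - ||grad w||^2 + ||grad (a - w)||^2. The last
    square absorbs f (a - w) by Young's inequality. *)
Lemma nudged_Picard_energy H C_I I_H mu w uk a :
  coarse_interpolation Omega H C_I I_H -> 0 <= mu ->
  V w -> V uk -> V a -> CDA_Picard_step Omega nu mu f I_H w uk a ->
  norm a.2 ^+ 2 <= norm w.2 ^+ 2 + (nu^-1 * F) ^+ 2
    + 2 * (nu^-1 * M * norm w.2) * norm uk.2 * norm a.2.
Proof.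
move=> hI mu0 Vw Vuk Va step.
have Xw := inV_inX Vw; have Xuk := inV_inX Vuk; have Xa := inV_inX Va.
have aw : a - w = -1 *: w + a by rewrite scaleN1r addrC.
have Vv : V (a - w) by rewrite aw; exact: inV_linear.
have := step _ Vv.
have := interpolation_dot_ge0 hI Xa Xw; move: (dot (fun x => I_H _ x - _) _) =>
  I I0.
have ga := inX_L2_grad Xa; have gw := inX_L2_grad Xw.
have -> : trilin Omega uk a (a - w) = - trilin Omega uk a w.
  rewrite aw (trilin_linear3 oO hM)// (trilin_skew oO hM Vuk Xa) addr0 mulN1r//.
have -> : dot a.2 (a - w).2 = norm a.2 ^+ 2 - dot a.2 w.2.
  by rewrite sqr_normL2 -(dotL2Br mO).
have D2 : norm (a - w).2 ^+ 2 = norm a.2 ^+ 2 - 2 * dot a.2 w.2 + norm w.2 ^+ 2.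
  rewrite !sqr_normL2 (_ : dot (a - w).2 (a - w).2 =
    dot (fun x => a.2 x - w.2 x) (fun x => a.2 x - w.2 x))//.
  rewrite (dotL2Bl mO)//; last exact: (L2mxB mO).
  by rewrite !(dotL2Br mO)// (dotL2C Omega w.2 a.2); lra.
have fb := le_trans (ler_norm _) (Hm1_bound (inV_inX Vv)).
have [_ _ tb] := hM Xuk Xa Xw.
move: D2 fb tb; set D := norm (a - w).2; set A := norm a.2; set W := norm w.2.
move: (dot a.2 w.2) (trilin Omega uk a w) (f _) => s t r.
set K := norm uk.2 => D2 fb tb e.
have muI : 0 <= mu * I by rewrite mulr_ge0.
(* The nudging term mu I is dropped here. *)
have main : nu * (A ^+ 2 - s) <= F * D + M * K * A * W by lra.
have -> : (nu^-1 * F) ^+ 2 = (F * F / nu) / nu by field; rewrite gt_eqF.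
have -> : 2 * (nu^-1 * M * W) * K * A = 2 * (M * K * A * W) / nu.
  by field; rewrite gt_eqF.
have yng : 2 * (F * D) <= F * F / nu + nu * D ^+ 2.
  have : 0 <= (F - nu * D) ^+ 2 / nu by rewrite divr_ge0 ?sqr_ge0// ltW.
  have -> : (F - nu * D) ^+ 2 / nu = F * F / nu + nu * D ^+ 2 - 2 * (F * D).
    by field; rewrite gt_eqF.
  by lra.
rewrite -addrA -mulrDl -lerBlDl ler_pdivlMr//.
have : nu * D ^+ 2 = nu * (A ^+ 2 - s) * 2 - nu * A ^+ 2 + nu * W ^+ 2
  by rewrite D2; ring.
by lra.
Qed.

End estimates.

(** The recursion contracts towards 3 S, so any bound above 3 S is eventually
    met. *)
Lemma eventually_le_of_contraction (R : realType) (a : nat -> R) (S : R) :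
  0 < S ->
  (forall k, a k.+1 <= 3 / 2 * S + 2^-1 * a k) ->
  \forall k \near \oo, a k.+1 <= 4 * S.
Proof.
move=> S0 ha.
have bnd k : a k - 3 * S <= 2^-1 ^+ k * `|a 0 - 3 * S|.
  elim: k => [|k IH]; first by rewrite expr0 mul1r ler_norm.
  have := ha k; rewrite exprS -mulrA; lra.
have c0 : (fun k => 2^-1 ^+ k * `|a 0 - 3 * S|) @ \oo --> (0 : R).
  rewrite -[X in _ --> X](mul0r `|a 0 - 3 * S|).
  apply: cvgM; last exact: cvg_cst.
  by apply: cvg_expr; rewrite ger0_norm ?invr_ge0// invf_lt1 ?ltr1n.
have : \forall k \near \oo, 2^-1 ^+ k * `|a 0 - 3 * S| < S
  by exact: (cvgr_lt 0 c0).
move=> [N _ hN]; exists N => // k /= Nk.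
have := hN k.+1 (leqW Nk); have := bnd k.+1; rewrite /=; lra.
Qed.

Theorem lemma4p2 (R : realType) (d : nat) (hd : d = 2%N \/ d = 3%N)
  (Omega : set 'rV[R]_d) (hOmega : flow_domain Omega)
  (M : R) (hM : trilinear_bounds Omega M)
  (nu : R) (hnu : 0 < nu)
  (f : vfield R d -> R) (hf : inHm1 Omega f)
  (C_I : R) (hC_I : 0 < C_I) (H : R) (hH : 0 < H)
  (I_H : ('rV[R]_d -> 'rV[R]_d) -> 'rV[R]_d -> 'rV[R]_d)
  (hI_H : coarse_interpolation Omega H C_I I_H)
  (mu : R) (hmu : 0 < mu)
  (delta : R) (hdelta : 0 <= delta)
  (halpha : alpha_delta delta M nu (normHm1 Omega f) < 3^-1)
  (u : vfield R d) (hu : steady_NS Omega nu f u)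
  (hu_infty : Linfty_gradient Omega u)
  (N : nat) (xs eps_i : 'I_N -> 'rV[R]_d)
  (hxs : forall i, closure Omega (xs i))
  (eps : vfield R d) (heps : inV Omega eps)
  (heps_i : forall i, I_H eps.1 (xs i) = eps_i i)
  (heps_delta : normL2 Omega (u + eps).2 <= (1 + delta) * normL2 Omega u.2)
  (us : nat -> vfield R d) (hus : forall k, inV Omega (us k))
  (hstep : forall k,
    CDA_Picard_step Omega nu mu f I_H (u + eps) (us k) (us k.+1)) :
  (\forall k \near \oo,
    normL2 Omega (us k.+1).2
      <= 2 * nu^-1 * normHm1 Omega f * Num.sqrt (1 + (1 + delta) ^+ 2)) /\
  2 * nu^-1 * normHm1 Omega f * Num.sqrt (1 + (1 + delta) ^+ 2)
    = C_delta delta * nu^-1 * normHm1 Omega f.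
Proof.
split; last by rewrite /C_delta; ring.
have [oO _ _] := hOmega.
have F0 := normHm1_ge0 hf.
have uF := steady_NS_bound oO hf hM hnu hu.
have [Vu _] := hu.
have Vw : inV Omega (u + eps) by rewrite -[u]scale1r; exact: inV_linear.
have energy k := nudged_Picard_energy oO hf hM hnu hI_H (ltW hmu) Vw (hus k)
  (hus k.+1) (hstep k).
move: heps_delta energy; set w := normL2 Omega (u + eps).2.
have w0 : 0 <= w by exact: normL2_ge0.
have a0 k : 0 <= normL2 Omega (us k).2 by exact: normL2_ge0.
have d1 : 0 <= 1 + delta by rewrite addr_ge0.
set F := normHm1 Omega f in F0 uF halpha *.
set G := nu^-1 * F in uF *.
have nuV : 0 < nu^-1 by rewrite invr_gt0.
have G0 : 0 <= G by rewrite mulr_ge0// ltW.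
pose a k := normL2 Omega (us k).2; rewrite -/(a _).
move=> wu energy.
have wG : w <= (1 + delta) * G by apply: (le_trans wu); exact: ler_wpM2l.
have w2 : w ^+ 2 <= (1 + delta) ^+ 2 * G ^+ 2.
  by rewrite -exprMn ler_sqr ?nnegrE//; exact: mulr_ge0.
pose S := (1 + (1 + delta) ^+ 2) * G ^+ 2.
have rhsE : (2 * nu^-1 * F * Num.sqrt (1 + (1 + delta) ^+ 2)) ^+ 2 = 4 * S.
  by rewrite exprMn sqr_sqrtr ?addr_ge0 ?sqr_ge0// /S /G; ring.
have rhs0 : 0 <= 2 * nu^-1 * F * Num.sqrt (1 + (1 + delta) ^+ 2).
  by rewrite !mulr_ge0 ?sqrtr_ge0// ltW.
have b13 : nu^-1 * M * w < 3^-1.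
  (* M may have any sign; for M <= 0 the coefficient is not positive. *)
  have [M0|M0] := leP M 0.
    apply: (@le_lt_trans _ _ 0); last by rewrite invr_gt0.
    by rewrite mulr_le0_ge0// mulr_ge0_le0// ltW.
  apply: le_lt_trans halpha; rewrite /alpha_delta.
  have -> : (1 + delta) * M * nu ^- 2 * F = nu^-1 * M * ((1 + delta) * G).
    by rewrite /G; field; rewrite gt_eqF.
  by rewrite ler_wpM2l// mulr_ge0 ?ltW.
have rec k : a k.+1 ^+ 2 <= 3 / 2 * S + 2^-1 * a k ^+ 2.
  have := energy k; rewrite -/(a _) -/(a _).
  have := a0 k; have := a0 k.+1; rewrite -/(a _) -/(a _).
  move: (a k) (a k.+1) => x y y0 x0 e.
  have xy : 0 <= x * y by rewrite mulr_ge0.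
  have h1 : 2 * (nu^-1 * M * w) * x * y <= 2 * 3^-1 * (x * y).
    by rewrite -mulrA ler_wpM2r// ler_wpM2l// ltW.
  have h2 : 2 * (x * y) <= x ^+ 2 + y ^+ 2 by have := sqr_ge0 (x - y); nra.
  have h3 : w ^+ 2 + G ^+ 2 <= S by rewrite /S mulrDl mul1r addrC lerD2l.
  by lra.
(* For F = 0 there is no room between 3 S and 4 S, but then w = 0 and the energy
   inequality alone gives a k.+1 = 0. *)
have [G1|Gn] := eqVneq G 0.
  apply: nearW => k.
  have wz : w = 0 by apply/le_anti; rewrite w0 andbT (le_trans wG)// G1 mulr0.
  have := energy k; rewrite wz G1 mulr0 expr0n /= addr0 mulr0 !mul0r addr0.
  rewrite exprn_even_le0//= => /eqP -> //.
have S0 : 0 < S.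
  by rewrite mulr_gt0 ?exprn_gt0// ?ltr_pwDl ?sqr_ge0// lt0r Gn.
apply: filterS (eventually_le_of_contraction S0 rec) => k.
by rewrite -rhsE ler_sqr ?nnegrE// a0.
Qed.
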